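(* Let $a<b$ be real numbers, let $f:\mathbb{N}_a\cap{_{b}\mathbb{N}}\to\mathbb{R}$ and let $f^*:\mathbb{N}_{-b}\cap{_{-a}\mathbb{N}}\to\mathbb{R}$, $f^*(t)=f(-t)$, be its symmetric dual. Let $n\geq 1$ be an integer and $n-1<\alpha\leq n$. Then for every $t\in\mathbb{N}_{a+n}\cap{_{b}\mathbb{N}}$, $$({^{C}\Delta_a^{\alpha}}f)(\rho^{\alpha}(t))=({^{C}_{-a}\Delta^{\alpha}}f^* )(-\rho^{\alpha}(t)),$$ where $\rho^{\alpha}(t)=t-\alpha$.
   Context: For real $a,b$: $\mathbb{N}_a=\{a,a+1,\ldots\}$, ${_{b}\mathbb{N}}=\{b,b-1,\ldots\}$. $\sigma(t)=t+1$. $\Delta f(t)=f(t+1)-f(t)$, $\nabla f(t)=f(t)-f(t-1)$, with iterates $\Delta^n,\nabla^n$, and $\nabla_{\circleddash}^n=(-1)^n\nabla^n$. Factorial function: $t^{(\alpha)}=\Gamma(t+1)/\Gamma(t+1-\alpha)$, with the convention that division at a pole yields zero. For $\beta>0$, delta left and right fractional sums: $$\Delta_a^{-\beta}h(t)=\frac{1}{\Gamma(\beta)}\sum_{s=a}^{t-\beta}(t-\sigma(s))^{(\beta-1)}h(s)\quad(t\in\mathbb{N}_{a+\beta}),\qquad {_{b}\Delta^{-\beta}}h(t)=\frac{1}{\Gamma(\beta)}\sum_{s=t+\beta}^{b}(s-\sigma(t))^{(\beta-1)}h(s)\quad(t\in{_{b-\beta}\mathbb{N}});$$ for $\beta=0$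 both operators are the identity. For $n-1<\alpha\leq n$, the delta left and right Caputo fractional differences are $${^{C}\Delta_a^{\alpha}}f(t)=\Delta_a^{-(n-\alpha)}(\Delta^n f)(t)\quad(t\in\mathbb{N}_{a+(n-\alpha)}),\qquad {^{C}_{b}\Delta^{\alpha}}f(t)={_{b}\Delta^{-(n-\alpha)}}(\nabla_{\circleddash}^n f)(t)\quad(t\in{_{b-(n-\alpha)}\mathbb{N}}).$$ For functions defined only on a finite set of points, these are considered at those $t$ for which all values occurring are defined. *)

(* Defs.v *)
From HB Require Import structures.
From mathcomp Require Import all_boot all_order all_algebra.
From mathcomp Require Import all_classical all_reals all_analysis.

Set Implicit Arguments.
Unset Strict Implicit.
Unset Printing Implicit Defensive.

Import Order.TTheory GRing.Theory Num.Theory.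

Local Open Scope classical_set_scope.
Local Open Scope ring_scope.

(* Discrete fractional calculus over a real field R.  A function defined on a
   set of points is represented by a total function R -> R; its values at
   points outside that set are meaningless. *)

(* {a, a + 1, a + 2, ...} *)
Definition Nup (R : realType) (a : R) : set R := range (fun k : nat => a + k%:R).

(* {b, b - 1, b - 2, ...} *)
Definition Ndown (R : realType) (b : R) : set R :=
  range (fun k : nat => b - k%:R).

Definition sigma (R : realType) (t : R) : R := t + 1.

Definition rho (R : realType) (alpha t : R) : R := t - alpha.

Definition delta (R : realType) (f : R -> R) : R -> R :=
  fun t => f (t + 1) - f t.

Definition nabla (R : realType) (f : R -> R) : R -> R :=
  fun t => f t - f (t - 1).

Definition deltan (R : realType) (n : nat) (f : R -> R) : R -> R :=
  iter n (@delta R) f.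

Definition nablan (R : realType) (n : nat) (f : R -> R) : R -> R :=
  iter n (@nabla R) f.

Definition nabla_ominus (R : realType) (n : nat) (f : R -> R) : R -> R :=
  fun t => (-1) ^+ n * nablan n f t.

(* Euler's integral, meaningful for 0 < x *)
Definition Gamma_pos (R : realType) (x : R) : R :=
  Rintegral (@lebesgue_measure R) `]0, +oo[
    (fun u : R => u `^ (x - 1) * expR (- u)).

(* For x <= 0, continuation by Gamma x = Gamma (x + m) / (x (x+1) ... (x+m-1)),
   with m the least natural number such that 0 < x + m.  At a pole the product
   vanishes and the value is the meaningless 0. *)
Definition Gamma (R : realType) (x : R) : R :=
  if 0 < x then Gamma_pos x
  else let m := (Num.truncn (- x)).+1 in
       Gamma_pos (x + m%:R) / \prod_(0 <= k < m) (x + k%:R).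

Definition Gamma_pole (R : realType) (x : R) : bool :=
  (x <= 0) && (x \is a Num.int).

(* t^(alpha); division at a pole yields zero *)
Definition ffact_real (R : realType) (t alpha : R) : R :=
  if Gamma_pole (t + 1 - alpha) then 0
  else Gamma (t + 1) / Gamma (t + 1 - alpha).

(* sum of F over s = lo, lo + 1, ..., hi (empty when hi = lo - 1);
   only used when hi - lo is an integer *)
Definition step_sum (R : realType) (lo hi : R) (F : R -> R) : R :=
  \sum_(s \in Nup lo `&` Ndown hi) F s.

Definition delta_left_sum (R : realType) (a beta : R) (h : R -> R) : R -> R :=
  fun t => if beta == 0 then h t
    else (Gamma beta)^-1 *
         step_sum a (t - beta) (fun s => ffact_real (t - sigma s) (beta - 1) * h s).

Definition delta_right_sum (R : realType) (b beta : R) (h : R -> R) : R -> R :=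
  fun t => if beta == 0 then h t
    else (Gamma beta)^-1 *
         step_sum (t + beta) b (fun s => ffact_real (s - sigma t) (beta - 1) * h s).

(* Caputo differences of order alpha, where n is the integer with
   n - 1 < alpha <= n. *)
Definition caputo_left (R : realType) (a : R) (n : nat) (alpha : R)
    (f : R -> R) : R -> R :=
  delta_left_sum a (n%:R - alpha) (deltan n f).

Definition caputo_right (R : realType) (b : R) (n : nat) (alpha : R)
    (f : R -> R) : R -> R :=
  delta_right_sum b (n%:R - alpha) (nabla_ominus n f).

(* fstar is the symmetric dual of f, a function on Nup a `&` Ndown b;
   nothing is required of fstar outside its own domain. *)
Definition symmetric_dual (R : realType) (a b : R) (f fstar : R -> R) : Prop :=
  forall t, (Nup (- b) `&` Ndown (- a)) t -> fstar t = f (- t).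

(* Main.v *)
(* The reflection s |-> -s turns the forward difference into minus the backward
   one, so (-1)^n nabla^n of the dual at -s is Delta^n f at s.  It also exchanges
   the two summation ranges and leaves the kernel (t - sigma(s))^(beta - 1)
   unchanged, so the two sums agree term by term.  Only the values f s, ...,
   f (s + n) with a <= s <= t - n occur, all inside the domain of f. *)

Require Import Defs.
From HB Require Import structures.
From mathcomp Require Import all_boot all_order all_algebra.
From mathcomp Require Import all_classical all_reals all_analysis.
From mathcomp Require Import ring.

Set Implicit Arguments.
Unset Strict Implicit.
Unset Printing Implicit Defensive.

Import Order.TTheory GRing.Theory Num.Theory.

Local Open Scope classical_set_scope.
Local Open Scope ring_scope.

Lemma nabla_ominus_opp (R : realType) (n : nat) (g : R -> R) (s : R) :
  nabla_ominus n g (- s) = deltan n (fun x => g (- x)) s.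
Proof.
rewrite /nabla_ominus; elim: n s => [|n IHn] s; first by rewrite expr0 mul1r.
rewrite /nablan /deltan !iterS /nabla /delta -/(nablan n g) -/(deltan n _).
by rewrite -!IHn opprD exprS mulN1r mulNr mulrBr opprB.
Qed.

(** Locality of [deltan]: it is needed because [fstar] is known to be the reflection of [f] only on
    its own domain. *)
Lemma eq_deltan (R : realType) (n : nat) (f g : R -> R) (s : R) :
  (forall k, (k <= n)%N -> f (s + k%:R) = g (s + k%:R)) ->
  deltan n f s = deltan n g s.
Proof.
elim: n s => [|n IHn] s fg; first by have := fg 0%N isT; rewrite addr0.
rewrite /deltan !iterS /delta -/(deltan n f) -/(deltan n g).
congr (_ - _); apply: IHn => k kn; last exact/fg/leqW.
by rewrite -addrA nat1r; exact: fg.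
Qed.

Lemma NupN (R : realType) (a x : R) : Nup (- a) (- x) <-> Ndown a x.
Proof.
split=> -[k _ kx]; exists k => //; last by rewrite -kx opprB addrC.
by apply: oppr_inj; rewrite -kx opprB addrC.
Qed.

Lemma NdownN (R : realType) (a x : R) : Ndown (- a) (- x) <-> Nup a x.
Proof. by rewrite -NupN !opprK. Qed.

Lemma step_sumN (R : realType) (lo hi : R) (F : R -> R) :
  step_sum (- hi) (- lo) F = step_sum lo hi (fun s => F (- s)).
Proof.
apply: reindex_fsbig; split.
- by move=> x [lox xhi]; split; [exact/NupN | exact/NdownN].
- by move=> x y _ _; exact: oppr_inj.
- move=> x [hix xlo]; exists (- x); last exact: opprK.
  by split; [apply/NdownN | apply/NupN]; rewrite opprK.
Qed.

Lemma deltan_symmetric_dual (R : realType) (a b : R) (f fstar : R -> R)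
    (n : nat) (s : R) :
  symmetric_dual a b f fstar -> Nup a s -> Ndown b (s + n%:R) ->
  nabla_ominus n fstar (- s) = deltan n f s.
Proof.
move=> fstarE [i _ si] [j _ sj]; rewrite nabla_ominus_opp.
apply: eq_deltan => k kn; rewrite fstarE ?opprK//; split.
  (* From [s + k] it takes [n - k] steps up to [s + n], then [j] more to [b]. *)
  apply/NupN; exists (j + (n - k))%N => //.
  rewrite natrD natrB// -[s](addrK n%:R) -sj; ring.
by apply/NdownN; exists (i + k)%N => //; rewrite natrD addrA si.
Qed.

Theorem theorem31 (R : realType) (a b : R) (f fstar : R -> R)
    (n : nat) (alpha : R) :
  a < b ->
  symmetric_dual a b f fstar ->
  (1 <= n)%N ->
  n%:R - 1 < alpha <= n%:R ->
  forall t : R, (Nup (a + n%:R) `&` Ndown b) t ->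
    caputo_left a n alpha f (rho alpha t)
    = caputo_right (- a) n alpha fstar (- rho alpha t).
Proof.
move=> _ fstarE _ _ t [[k _ tk] [j _ tj]].
rewrite /caputo_left /caputo_right /delta_left_sum /delta_right_sum /rho.
have tnE : t - alpha - (n%:R - alpha) = t - n%:R.
  by ring.
case: eqP => [/eqP|_].
  (* Here [alpha = n]: no sum is left, only the difference identity at [t - n]. *)
  rewrite subr_eq0 => /eqP <-; apply/esym/(deltan_symmetric_dual fstarE).
    by exists k => //; rewrite -tk addrAC addrK.
  by rewrite subrK; exists j.
(* The right sum starts at the mirror image of the endpoint [t - n] of the left sum. *)
have -> : - (t - alpha) + (n%:R - alpha) = - (t - n%:R).
  by ring.
rewrite tnE step_sumN; congr (_ * _); apply: eq_fsbigr => s.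
rewrite inE => -[as_ [i _ si]].
rewrite (deltan_symmetric_dual fstarE)//; last first.
  (* As [s = t - n - i] and [t = b - j], the last point used, [s + n], is [b - (j + i)]. *)
  exists (j + i)%N => //; rewrite natrD opprD addrA tj -si.
  by rewrite addrAC subrK.
(* Both kernel arguments equal [t - alpha - s - 1]. *)
congr (ffact_real _ _ * _); rewrite /sigma !opprD opprK; ring.
Qed.
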